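(* Let $k\ge 1$ be a fixed integer and let $G_k^{(n)}$, $n\in\mathbb N_0$, be a sequence transformation satisfying (H-0)--(H-3) of the context, with associated transformation $g_k^{(n)}$. Let $\rho$ be a real number with $0<|\rho|<1$. Then $G_k^{(n)}$ accelerates the convergence of the sequences $\{s_n\}$ which converge linearly to some limit $s$ with $$\lim_{n\to\infty}\frac{s_{n+1}-s}{s_n-s}=\rho$$ (i.e. accelerates every such sequence) if and only if $$\lim_{n\to\infty} g_k^{(n)}(\rho_n,\rho_{n+1},\ldots,\rho_{n+k-2}) \;=\; g_k^{(\infty)}(\rho,\rho,\ldots,\rho)\;=\;\frac{1}{1-\rho}$$ for arbitrary sequences $\{\rho_n\}$ of real numbers converging to $\rho$. Equivalently, in terms of the limiting transformation $G_k^{(\infty)}$, the condition reads $$\lim_{n\to\infty}G_k^{(n)}\Bigl(0,1,1+\rho_n,\ldots,\sum_{j=0}^{k-1}\prod_{i=0}^{j-1}\rho_{n+i}\Bigr)\;=\;G_k^{(\infty)}\Bigl(0,1,1+\rho,\ldots,\sum_{j=0}^{k-1}\rho^j\Bigr)\;=\;\frac{1}{1-\rho}.$$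
   Context: All sequences are real. For fixed $k$, a sequence transformation $G_k^{(n)}$ ($n\in\mathbb N_0$) is a real-valued function of $k+1$ real variables, possibly depending explicitly on $n$, with the following properties for all $n$. (H-0) $G_k^{(n)}$ is defined and continuous on a subset $X^{(n)}\subset\mathbb R^{k+1}$. (H-1) $G_k^{(n)}(\lambda x_1,\ldots,\lambda x_{k+1})=\lambda\,G_k^{(n)}(x_1,\ldots,x_{k+1})$ for $x\in X^{(n)}$ and all $\lambda\in\mathbb R$ with $\lambda x\in X^{(n)}$. (H-2) $G_k^{(n)}(x_1+t,\ldots,x_{k+1}+t)=G_k^{(n)}(x_1,\ldots,x_{k+1})+t$ for $x\in X^{(n)}$ and $t\in\mathbb R$. (H-3) There is a subset $X^{(\infty)}\subset\mathbb R^{k+1}$ on which the limiting transformation $G_k^{(\infty)}(x)=\lim_{n\to\infty}G_k^{(n)}(x)$ is uniquely defined and continuous, and $G_k^{(\infty)}$ also satisfies the homogeneity (H-1) and translation property (H-2). The sets $X^{(n)}$ are understood to be stable under translation by $(t,\ldots,t)$ and under multiplication by nonzero reals. The associated transformation is $$g_k^{(n)}(y_1,\ldots,y_{k-1})=G_k^{(n)}\Bigl(0,1,1+y_1,\ldots,\sum_{j=0}^{k-1}\prod_{i=1}^{j}y_i\Bigr)$$ (the $(\nu+1)$-th argument is $\sum_{j=0}^{\nu-1}\prod_{i=1}^{j}y_i$, $0\le\nu\le k$), for vectors $y$ for which the right-hand side is defined, and $g_k^{(\infty)}=\lim_{n\to\infty}g_k^{(n)}$. Empty products are $1$, empty sums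 are $0$. With $\Delta s_n=s_{n+1}-s_n$ this means $G_k^{(n)}(s_n,\ldots,s_{n+k})=s_n+\Delta s_n\,g_k^{(n)}(\Delta s_{n+1}/\Delta s_n,\ldots,\Delta s_{n+k-1}/\Delta s_{n+k-2})$ whenever the expressions are defined. $G_k^{(n)}$ accelerates the convergence of a sequence $\{s_n\}$ with limit $s$ if $G_k^{(n)}(s_n,\ldots,s_{n+k})$ is defined for all sufficiently large $n$ and $$\lim_{n\to\infty}\frac{G_k^{(n)}(s_n,s_{n+1},\ldots,s_{n+k})-s}{s_n-s}=0.$$ A limit statement about $g_k^{(n)}$ or $G_k^{(n)}$ includes that the terms are defined for all sufficiently large $n$. *)

(* Defs.v *)
From HB Require Import structures.
From mathcomp Require Import all_boot all_order all_algebra.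
From mathcomp Require Import all_classical all_reals all_analysis.

Set Implicit Arguments.
Unset Strict Implicit.
Unset Printing Implicit Defensive.

Import Order.TTheory GRing.Theory Num.Theory.
Import numFieldNormedType.Exports.

Local Open Scope classical_set_scope.
Local Open Scope ring_scope.

(* A real-valued function of m real variables given on a subset [fdom] of R^m;
   the values of [fval] outside [fdom] are irrelevant. *)
Record partial_fun (R : realType) (m : nat) := PartialFun {
  fdom : set 'rV[R]_m ;
  fval :> 'rV[R]_m -> R }.

(* lim_n F_n(x_n) = l, including that F_n(x_n) is defined for all large n. *)
Definition plim (R : realType) (m : nat) (F : nat -> partial_fun R m)
    (x : nat -> 'rV[R]_m) (l : R) : Prop :=
  (\forall n \near \oo, fdom (F n) (x n)) /\ (F n (x n) @[n --> \oo] --> l).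

(* The pointwise limit of a sequence of partial functions, on the set of all
   points where this limit exists. *)
Definition limmap (R : realType) (m : nat) (F : nat -> partial_fun R m) : partial_fun R m :=
  PartialFun [set x | exists l, plim F (fun=> x) l]
       (fun x => lim (F n x @[n --> \oo])).

Definition translation_stable (R : realType) (m : nat) (X : set 'rV[R]_m) :=
  forall (x : 'rV[R]_m) (t : R), X x -> X (x + const_mx t).

Definition scaling_stable (R : realType) (m : nat) (X : set 'rV[R]_m) :=
  forall (x : 'rV[R]_m) (a : R), a != 0 -> X x -> X (a *: x).

Definition homogeneous (R : realType) (m : nat) (X : set 'rV[R]_m)
    (f : 'rV[R]_m -> R) :=
  forall (x : 'rV[R]_m) (a : R), X x -> X (a *: x) -> f (a *: x) = a * f x.

Definition translative (R : realType) (m : nat) (X : set 'rV[R]_m)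
    (f : 'rV[R]_m -> R) :=
  forall (x : 'rV[R]_m) (t : R), X x -> f (x + const_mx t) = f x + t.

Record regular_on (R : realType) (m : nat) (X : set 'rV[R]_m)
    (f : 'rV[R]_m -> R) : Prop := RegularOn {
  regular_translation_stable : translation_stable X ;
  regular_scaling_stable : scaling_stable X ;
  regular_continuous : {within X, continuous f} ;
  regular_homogeneous : homogeneous X f ;
  regular_translative : translative X f }.

(* The set X^(oo) of the limiting transformation is some subset of the set of
   convergence of G^(n); it need not be all of it. *)
Record sequence_transformation (R : realType) (k : nat)
    (G : nat -> partial_fun R k.+1) : Prop := SequenceTransformation {
  transformation_regular : forall n, regular_on (fdom (G n)) (G n) ;
  transformation_limit : exists2 Xoo : set 'rV[R]_k.+1,
    Xoo `<=` fdom (limmap G) & regular_on Xoo (limmap G) }.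

(* (0, 1, 1 + y_1, ..., \sum_(j < k) y_1 ... y_j); the variable y_(i+1) is the
   entry [y 0 i] with i < k - 1. *)
Definition partial_sums (R : realType) (k : nat) (y : 'rV[R]_k.-1) :
    'rV[R]_k.+1 :=
  \row_(v < k.+1) \sum_(j < v) \prod_(i < k.-1 | (i < j)%N) y 0 i.

Definition associated (R : realType) (k : nat) (G : nat -> partial_fun R k.+1)
    (n : nat) : partial_fun R k.-1 :=
  PartialFun [set y | fdom (G n) (partial_sums y)] (fun y => G n (partial_sums y)).

(* (u_n, u_(n+1), ..., u_(n+m-1)) *)
Definition window (R : realType) (m : nat) (u : nat -> R) (n : nat) :
    'rV[R]_m :=
  \row_(i < m) u (n + i)%N.

(* As x / 0 = 0 in the library, that the quotients are eventually defined is
   required separately, here and in [accelerates]. *)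
Definition converges_linearly (R : realType) (s : nat -> R) (l rho : R) :=
  [/\ s n @[n --> \oo] --> l,
      \forall n \near \oo, s n != l &
      (s n.+1 - l) / (s n - l) @[n --> \oo] --> rho].

Definition accelerates (R : realType) (k : nat) (G : nat -> partial_fun R k.+1)
    (s : nat -> R) (l : R) :=
  [/\ \forall n \near \oo, fdom (G n) (window k.+1 s n),
      \forall n \near \oo, s n != l &
      (G n (window k.+1 s n) - l) / (s n - l) @[n --> \oo] --> (0 : R)].

(* Main.v *)
(** Put [d n = s n.+1 - s n] and [r n = d n.+1 / d n].  Homogeneity and
    translativity give
      [(G n (s n, ..., s (n+k)) - l) / (s n - l) = 1 + d n / (s n - l) * g n (r n, ..., r (n+k-2))]
    and linear convergence gives [d n / (s n - l) --> rho - 1], so that [s] is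
    accelerated exactly when [g n (r n, ...)] tends to [1 / (1 - rho)].  It
    remains to see that every sequence [r] tending to [rho] is eventually the
    sequence of quotients of some linearly convergent [s]: one takes
    [s n = r 0 * ... * r n.-1 * T n] with [T] the bounded solution of
    [T n = 1 + r n * T n.+1], so that [d n = - (r 0 * ... * r n.-1)] and
    [T n --> 1 / (1 - rho)]. *)

Require Import Defs.
From HB Require Import structures.
From mathcomp Require Import all_boot all_order all_algebra.
From mathcomp Require Import all_classical all_reals all_analysis.
From mathcomp Require Import ring lra zify.

Set Implicit Arguments.
Unset Strict Implicit.
Unset Printing Implicit Defensive.

Import Order.TTheory GRing.Theory Num.Theory.
Import numFieldNormedType.Exports.
Local Open Scope classical_set_scope.
Local Open Scope ring_scope.

(** * The bounded solution of [T n = 1 + r n * T n.+1] *)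

Section ShiftedProducts.
Variables (R : realType) (r : nat -> R).

Definition shifted_prod (n j : nat) : R := \prod_(i < j) r (n + i)%N.

Lemma shifted_prodS n j :
  shifted_prod n j.+1 = r n * shifted_prod n.+1 j.
Proof.
rewrite /shifted_prod big_ord_recl addn0; congr (_ * _).
by apply: eq_bigr => i _; rewrite lift0 addnS addSn.
Qed.

Lemma shifted_prodSr n j :
  shifted_prod n j.+1 = shifted_prod n j * r (n + j)%N.
Proof. by rewrite /shifted_prod big_ord_recr. Qed.

(** Iterating [T n = 1 + r n * T n.+1] forever produces this series; the bound [c < 1] on [r] makes
    the limit genuine. *)
Definition tail_sum (n : nat) : R := limn (series (shifted_prod n)).

Variable c : R.
Hypothesis c_lt1 : c < 1.
Hypothesis r_le_c : forall n, `|r n| <= c.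

Let c_ge0 : 0 <= c. Proof. exact: le_trans (r_le_c 0). Qed.

Lemma norm_shifted_prod n j : `|shifted_prod n j| <= geometric 1 c j.
Proof.
rewrite /= mul1r.
elim: j => [|j IH]; first by rewrite /shifted_prod big_ord0 normr1 expr0.
rewrite shifted_prodSr normrM exprSr.
by apply: ler_pM.
Qed.

Let norm_c_lt1 : `|c| < 1. Proof. by rewrite ger0_norm. Qed.

Lemma normed_cvg_tail_sum n : cvgn [normed series (shifted_prod n)].
Proof.
apply: (@series_le_cvg _ _ (geometric 1 c)) => [j|j|j|].
- exact: normr_ge0.
- by rewrite /= mul1r exprn_ge0.
- exact: norm_shifted_prod.
- exact: is_cvg_geometric_series.
Qed.

Lemma cvg_tail_sum n : series (shifted_prod n) m @[m --> \oo] --> tail_sum n.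
Proof. exact: normed_cvg (@normed_cvg_tail_sum n). Qed.

Lemma shifted_prod_cvg0 n : shifted_prod n m @[m --> \oo] --> (0 : R).
Proof. by apply: cvg_series_cvg_0; apply: cvgP; exact: cvg_tail_sum. Qed.

Lemma norm_tail_sum n : `|tail_sum n| <= (1 - c)^-1.
Proof.
apply: le_trans (lim_series_norm (@normed_cvg_tail_sum n)) _.
have gc := @cvg_geometric_series R 1 c norm_c_lt1.
have -> : (1 - c)^-1 = limn (series (geometric 1 c)).
  by rewrite (cvg_lim _ gc) // mul1r.
apply: lim_series_le => [|| j].
- exact: normed_cvg_tail_sum.
- exact: is_cvg_geometric_series.
- exact: norm_shifted_prod.
Qed.

Lemma tail_sum_rec n : tail_sum n = 1 + r n * tail_sum n.+1.
Proof.
apply: (@cvg_lim _ _ _ \oo); first exact: Rhausdorff.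
(* With one more term, the partial sum from [n] is [1] plus [r n] times the partial sum from
   [n.+1]. *)
rewrite -cvg_shiftS.
have -> : [sequence series (shifted_prod n) m.+1]_m =
    (fun m => 1 + r n * series (shifted_prod n.+1) m).
  apply/funext => m; rewrite /= /series /= big_nat_recl //.
  rewrite {1}/shifted_prod big_ord0 mulr_sumr; congr (_ + _).
  by apply: eq_bigr => i _; rewrite shifted_prodS.
by apply: cvgD; [exact: cvg_cst|apply: cvgMr; exact: cvg_tail_sum].
Qed.

End ShiftedProducts.

(** * Linearly convergent sequences with prescribed difference quotients *)

(** The recursion bounds [u n] by its successor, so the bound [M] replaces an initial value:
    unrolling [m] steps leaves [c ^+ m * M] plus a small error, and [m] is free to tend to infinity
    while [n] stays fixed. *)
Lemma bounded_contraction_cvg0 (R : realType) (u e : nat -> R) (c M : R) :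
  0 <= c < 1 -> (forall n, `|u n| <= M) -> e n @[n --> \oo] --> (0 : R) ->
  (forall n, `|u n| <= c * `|u n.+1| + e n) -> u n @[n --> \oo] --> (0 : R).
Proof.
move=> /andP[c0 c1] uM e0 urec.
have c'gt0 : 0 < 1 - c by rewrite subr_gt0.
apply/cvgr0Pnorm_le => eps eps0.
(* Errors below this threshold keep [eps] stable, as [c * eps + eps * (1 - c) = eps]. *)
have d0 : 0 < eps * (1 - c) by exact: mulr_gt0.
have /cvgr0Pnorm_le /(_ _ d0) [N _ Ne] := e0.
exists N => // n /= Nn.
have bound m : forall p, (N <= p)%N -> `|u p| <= c ^+ m * M + eps.
  elim: m => [|m IH] p Np; first by rewrite expr0 mul1r ler_wpDr // ltW.
  apply: le_trans (urec p) _.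
  have := IH p.+1 (leqW Np) => /(ler_wpM2l c0) h.
  have := le_trans (ler_norm _) (Ne p Np) => h'.
  by rewrite exprS; lra.
have : (fun m => c ^+ m * M + eps) @ \oo --> 0 * M + eps.
  apply: cvgD; last exact: cvg_cst.
  by apply: cvgMl; apply: cvg_expr; rewrite ger0_norm.
rewrite mul0r add0r => /cvgr_to_ge; apply.
by apply: nearW => m; exact: bound.
Qed.

(** The limit [L] is the fixed point of [T = 1 + rho * T]; subtracting the two recursions gives a
    contraction for [tail_sum r n - L] with error [(r n - rho) * L]. *)
Lemma tail_sum_cvg (R : realType) (r : nat -> R) (c rho : R) :
  c < 1 -> (forall n, `|r n| <= c) -> r n @[n --> \oo] --> rho ->
  rho != 1 ->
  tail_sum r n @[n --> \oo] --> (1 - rho)^-1.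
Proof.
move=> c1 rc rr rho1.
have c0 : 0 <= c by exact: le_trans (rc 0%N).
have rho1' : 1 - rho != 0 by rewrite subr_eq0 eq_sym.
set L := (1 - rho)^-1.
have LE : L = 1 + rho * L by rewrite /L; field.
apply/subr_cvg0; apply: (@bounded_contraction_cvg0 _ _
    (fun n => `|r n - rho| * `|L|) c ((1 - c)^-1 + `|L|)).
- by rewrite c0.
- move=> n; apply: le_trans (ler_normB _ _) _.
  by rewrite lerD2r (norm_tail_sum c1 rc).
- rewrite -(mul0r `|L|); apply: cvgMl.
  by apply/norm_cvg0P/subr_cvg0.
- move=> n /=; rewrite (tail_sum_rec c1 rc) [in X in X <= _]LE.
  have -> : 1 + r n * tail_sum r n.+1 - (1 + rho * L) =
      r n * (tail_sum r n.+1 - L) + (r n - rho) * L by ring.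
  apply: le_trans (ler_normD _ _) _; rewrite !normrM lerD2r.
  exact: ler_wpM2r.
Qed.

Lemma exists_linear_sequence (R : realType) (r : nat -> R) (rho : R) :
  0 < `|rho| < 1 -> r n @[n --> \oo] --> rho ->
  exists s : nat -> R, converges_linearly s 0 rho /\
    \forall n \near \oo, s n.+2 - s n.+1 = r n * (s n.+1 - s n).
Proof.
move=> /andP[rho_gt0 rho_lt1] rr.
have rho0 : rho != 0 by rewrite -normr_gt0.
have rho1 : rho != 1 by apply: contraTneq rho_lt1 => ->; rewrite normr1 ltxx.
(* The midpoint of [|rho|] and [1] leaves room on both sides. *)
pose c := (1 + `|rho|) / 2.
have c1 : c < 1 by rewrite /c; lra.
have rhoc : `|rho| < c by rewrite /c; lra.
have [N _ rN] : \forall n \near \oo, `|r n| <= c /\ r n != 0.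
  near=> n; split; last by near: n; exact: cvgr_neq0 rr rho0.
  by apply: ltW; near: n; exact: cvgr_norm_lt rr _ rhoc.
(* [r] is altered at finitely many places so that its bounds hold everywhere *)
pose q n := if (N <= n)%N then r n else rho.
have qr : \forall n \near \oo, q n = r n.
  by exists N => // n /= Nn; rewrite /q Nn.
have q_cvg : q n @[n --> \oo] --> rho.
  by apply: cvg_trans rr; apply: near_eq_cvg; near do apply/esym.
have qc n : `|q n| <= c.
  by rewrite /q; case: leqP => [/rN[]//|_]; exact: ltW.
have q0 n : q n != 0 by rewrite /q; case: leqP => [/rN[]|].
pose d := shifted_prod q 0.
have dS n : d n.+1 = q n * d n by rewrite /d shifted_prodSr mulrC.
have d0 n : d n != 0 by apply/prodf_neq0.
pose T := tail_sum q.
have TS n : T n = 1 + q n * T n.+1 := tail_sum_rec c1 qc n.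
have T_cvg : T n @[n --> \oo] --> (1 - rho)^-1 := tail_sum_cvg c1 qc q_cvg rho1.
have L0 : (1 - rho)^-1 != 0 by rewrite invr_eq0 subr_eq0 eq_sym.
have T0 : \forall n \near \oo, T n != 0 by exact: cvgr_neq0 T_cvg L0.
have DS n : d n.+1 * T n.+1 - d n * T n = - d n.
  by rewrite dS [in X in _ - X]TS; ring.
exists (fun n => d n * T n); split; last first.
  near=> n; rewrite !DS dS mulrN; congr (- (_ * _)).
  by near: n.
split.
- rewrite -(mul0r (1 - rho)^-1); apply: cvgM => //.
  exact: (shifted_prod_cvg0 c1 qc).
- by near=> n; rewrite mulf_neq0//; near: n.
(* The factor [d n] cancels in the quotient of errors, and [T n.+1 / T n] tends to [1] because the
   limit of [T] is nonzero. *)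
- have : (fun n => q n * T n.+1 / T n) @ \oo -->
      rho * (1 - rho)^-1 / (1 - rho)^-1.
    apply: cvgM; last exact: cvgV.
    by apply: cvgM => //; rewrite (cvg_shiftS T).
  rewrite mulfK //; apply: cvg_trans; apply: near_eq_cvg; near=> n.
  have Tn : T n != 0 by near: n.
  by rewrite !subr0 dS; field; rewrite Tn d0.
Unshelve. all: by end_near. Qed.

(** * Windows of a sequence as affine images of partial sums *)

Definition sums_of_shifted_prods (R : realType) (k : nat) (r : nat -> R)
    (n : nat) : 'rV[R]_k.+1 :=
  \row_(v < k.+1) \sum_(j < v) shifted_prod r n j.

Lemma partial_sums_window (R : realType) (k : nat) (r : nat -> R) (n : nat) :
  partial_sums (window k.-1 r n) = sums_of_shifted_prods k r n.
Proof.
apply/rowP => v; rewrite !mxE; apply: eq_bigr => j _.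
(* Since [j < v <= k], no product runs past the [k.-1] available variables. *)
have jk : (j <= k.-1)%N.
  by have := ltn_ord j; have := ltn_ord v; lia.
rewrite /shifted_prod (big_ord_widen _ (fun i => r (n + i)%N) jk).
by apply: eq_bigr => i _; rewrite mxE.
Qed.

Lemma partial_sums_const (R : realType) (k : nat) (x : R) :
  partial_sums (const_mx x) = \row_(v < k.+1) \sum_(j < v) x ^+ j.
Proof.
have -> : const_mx x = window k.-1 (fun=> x) 0 by apply/rowP => i; rewrite !mxE.
rewrite partial_sums_window; apply/rowP => v; rewrite !mxE.
by apply: eq_bigr => j _; rewrite /shifted_prod prodr_const card_ord.
Qed.

(** Each later difference is the first one times a product of consecutive [r i], and the differences
    telescope. *)
Lemma window_decomposition (R : realType) (k : nat) (s r : nat -> R) (n : nat) :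
  (forall i, (n <= i)%N -> s i.+2 - s i.+1 = r i * (s i.+1 - s i)) ->
  window k.+1 s n =
    (s n.+1 - s n) *: sums_of_shifted_prods k r n + const_mx (s n).
Proof.
move=> sr.
have Ds j : s (n + j.+1)%N - s (n + j)%N = (s n.+1 - s n) * shifted_prod r n j.
  elim: j => [|j IH]; first by rewrite addn1 addn0 /shifted_prod big_ord0 mulr1.
  rewrite shifted_prodSr mulrA -IH mulrC !addnS; apply: sr.
  exact: leq_addr.
apply/rowP => v; rewrite !mxE mulr_sumr.
under eq_bigr do rewrite -Ds.
rewrite -(big_mkord xpredT (fun j => s (n + j.+1)%N - s (n + j)%N)).
by rewrite (telescope_sumr (fun j => s (n + j)%N)) // addn0 subrK.
Qed.

Section RegularAtWindow.
Variables (R : realType) (m : nat) (X : set 'rV[R]_m) (f : 'rV[R]_m -> R).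
Hypothesis Xf : regular_on X f.

(** For the forward direction, translate by [- t] and scale by [a^-1]. *)
Lemma regular_dom_affine (a t : R) (x : 'rV[R]_m) :
  a != 0 -> X (a *: x + const_mx t) <-> X x.
Proof.
move=> a0; split => [Xx|Xx]; last first.
  by apply: (regular_translation_stable Xf); apply: (regular_scaling_stable Xf).
have := regular_translation_stable Xf (- t) Xx.
have -> : a *: x + const_mx t + const_mx (- t) = a *: x.
  by apply/rowP => i; rewrite !mxE addrK.
have ai0 : a^-1 != 0 by rewrite invr_eq0.
by move=> /(regular_scaling_stable Xf ai0); rewrite scalerA mulVf // scale1r.
Qed.

Lemma regular_val_affine (a t : R) (x : 'rV[R]_m) :
  a != 0 -> X x -> f (a *: x + const_mx t) = a * f x + t.
Proof.
move=> a0 Xx; have Xax := regular_scaling_stable Xf a0 Xx.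
by rewrite (regular_translative Xf) // (regular_homogeneous Xf).
Qed.

End RegularAtWindow.

(** The relation on [r] is in product form and only eventual, which suits both a prescribed [r] and
    the actual quotients of a given [s]. *)
Lemma accelerates_iff_plim (R : realType) (k : nat)
    (G : nat -> partial_fun R k.+1) (s r : nat -> R) (l rho : R) :
  (forall n, regular_on (fdom (G n)) (G n)) -> rho != 1 ->
  converges_linearly s l rho ->
  (\forall n \near \oo, s n.+2 - s n.+1 = r n * (s n.+1 - s n)) ->
  accelerates G s l <-> plim G (sums_of_shifted_prods k r) (1 - rho)^-1.
Proof.
move=> Greg rho1 [sl sNl srho] [N _ sr].
set S := sums_of_shifted_prods k r.
pose q n := (s n.+1 - s n) / (s n - l).
have q_cvg : q n @[n --> \oo] --> rho - 1.
  have : (fun n => (s n.+1 - l) / (s n - l) - 1) @ \oo --> rho - 1.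
    by apply: cvgB => //; exact: cvg_cst.
  apply: cvg_trans; apply: near_eq_cvg; near=> n.
  have : s n != l by near: n.
  by rewrite -subr_eq0 => snl; rewrite /q; field.
have rho1' : rho - 1 != 0 by rewrite subr_eq0.
(* This allows solving for [G n (S n)] and makes the scaling factor [s n.+1 - s n] nonzero. *)
have q0 : \forall n \near \oo, q n != 0 by exact: cvgr_neq0 q_cvg rho1'.
have D0 : \forall n \near \oo, s n.+1 - s n != 0.
  near=> n; have : q n != 0 by near: n.
  by rewrite mulf_eq0 negb_or => /andP[].
have decomp : \forall n \near \oo,
    window k.+1 s n = (s n.+1 - s n) *: S n + const_mx (s n).
  exists N => // n /= Nn; apply: window_decomposition => i ni.
  by apply: sr => /=; exact: leq_trans ni.
have dom : \forall n \near \oo,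
    fdom (G n) (window k.+1 s n) <-> fdom (G n) (S n).
  near=> n; have -> : window k.+1 s n = (s n.+1 - s n) *: S n + const_mx (s n).
    by near: n.
  by apply: (regular_dom_affine (Greg n)); near: n.
have val : \forall n \near \oo, fdom (G n) (S n) ->
    (G n (window k.+1 s n) - l) / (s n - l) = 1 + q n * G n (S n).
  near=> n => dS.
  have -> : window k.+1 s n = (s n.+1 - s n) *: S n + const_mx (s n).
    by near: n.
  rewrite (regular_val_affine (Greg n)) //; last by near: n.
  have : s n != l by near: n.
  by rewrite -subr_eq0 => snl; rewrite /q; field.
split=> [[dw _ acc]|[dS lim]].
- have dS : \forall n \near \oo, fdom (G n) (S n).
    near=> n.
    have domn : fdom (G n) (window k.+1 s n) <-> fdom (G n) (S n) by near: n.
    by apply/domn; near: n.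
  split=> //.
  have : (fun n => ((G n (window k.+1 s n) - l) / (s n - l) - 1) / q n)
      @ \oo --> (0 - 1) / (rho - 1).
    apply: cvgM; last exact: cvgV.
    by apply: cvgB => //; exact: cvg_cst.
  have -> : (0 - 1) / (rho - 1) = (1 - rho)^-1.
    by field; rewrite rho1' subr_eq0 eq_sym rho1.
  apply: cvg_trans; apply: near_eq_cvg; near=> n.
  have -> : (G n (window k.+1 s n) - l) / (s n - l) = 1 + q n * G n (S n).
    have : fdom (G n) (S n) by near: n.
    by near: n.
  have qn0 : q n != 0 by near: n.
  by field.
- have dw : \forall n \near \oo, fdom (G n) (window k.+1 s n).
    near=> n.
    have domn : fdom (G n) (window k.+1 s n) <-> fdom (G n) (S n) by near: n.
    by apply/domn; near: n.
  split=> //.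
  have : (fun n => 1 + q n * G n (S n)) @ \oo --> 1 + (rho - 1) * (1 - rho)^-1.
    by apply: cvgD; [exact: cvg_cst|exact: cvgM].
  have -> : 1 + (rho - 1) * (1 - rho)^-1 = 0.
    by field; rewrite subr_eq0 eq_sym.
  apply: cvg_trans; apply: near_eq_cvg; near=> n.
  have Sn : fdom (G n) (S n) by near: n.
  by apply/esym; move: Sn; near: n.
Unshelve. all: by end_near. Qed.

(** With [p n] the quotient of successive errors, the difference quotient equals
    [p n * (p n.+1 - 1) / (p n - 1)]. *)
Lemma cvg_difference_quotient (R : realType) (s : nat -> R) (l rho : R) :
  rho != 1 -> converges_linearly s l rho ->
  (s n.+2 - s n.+1) / (s n.+1 - s n) @[n --> \oo] --> rho.
Proof.
move=> rho1 [_ sNl srho].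
pose p n := (s n.+1 - l) / (s n - l).
have rho1' : rho - 1 != 0 by rewrite subr_eq0.
have sNlS : \forall n \near \oo, s n.+1 != l.
  by case: sNl => N _ sN; exists N => // n /= Nn; apply: sN; exact: leqW.
have p1 : p n - 1 @[n --> \oo] --> rho - 1.
  by apply: cvgB => //; exact: cvg_cst.
have p1N0 : \forall n \near \oo, p n - 1 != 0 by exact: cvgr_neq0 p1 rho1'.
have : (fun n => p n * (p n.+1 - 1) / (p n - 1)) @ \oo -->
    rho * (rho - 1) / (rho - 1).
  apply: cvgM; last exact: cvgV.
  by apply: cvgM => //; rewrite (cvg_shiftS (fun n => p n - 1)).
rewrite mulfK //; apply: cvg_trans; apply: near_eq_cvg; near=> n.
have snl : s n - l != 0 by rewrite subr_eq0; near: n.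
have sn1l : s n.+1 - l != 0 by rewrite subr_eq0; near: n.
have pE : p n - 1 = (s n.+1 - s n) / (s n - l) by rewrite /p; field.
have : p n - 1 != 0 by near: n.
rewrite pE mulf_eq0 negb_or => /andP[D0 _].
by rewrite /p; field; rewrite snl sn1l D0.
Unshelve. all: by end_near. Qed.

(** * Assembling the two equivalences *)

Theorem mainTheorem1 (R : realType) (k : nat) (hk : (1 <= k)%N)
    (G : nat -> partial_fun R k.+1) (hG : sequence_transformation G)
    (rho : R) (hrho0 : 0 < `|rho|) (hrho1 : `|rho| < 1) :
  let g := associated G in
  let goo := limmap g in
  let Goo := limmap G in
  let accelerates_all :=
    forall (s : nat -> R) (l : R),
      converges_linearly s l rho -> accelerates G s l in
  let condition_g :=
    forall r : nat -> R, r n @[n --> \oo] --> rho ->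
      [/\ plim g (window k.-1 r) (goo (const_mx rho)),
          fdom goo (const_mx rho) &
          goo (const_mx rho) = 1 / (1 - rho)] in
  let condition_G :=
    forall r : nat -> R, r n @[n --> \oo] --> rho ->
      [/\ plim G
            (fun n => \row_(v < k.+1) \sum_(j < v) \prod_(i < j) r (n + i)%N)
            (Goo (\row_(v < k.+1) \sum_(j < v) rho ^+ j)),
          fdom Goo (\row_(v < k.+1) \sum_(j < v) rho ^+ j) &
          Goo (\row_(v < k.+1) \sum_(j < v) rho ^+ j) = 1 / (1 - rho)] in
  (accelerates_all <-> condition_g) /\ (condition_g <-> condition_G).
Proof.
move=> g goo Goo accelerates_all condition_g condition_G.
have rho1 : rho != 1 by apply: contraTneq hrho1 => ->; rewrite normr1 ltxx.
have Greg := transformation_regular hG.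
set L := (1 - rho)^-1.
have gooE : goo (const_mx rho) = Goo (\row_(v < k.+1) \sum_(j < v) rho ^+ j).
  by rewrite /goo /Goo /= partial_sums_const.
have domE : fdom goo (const_mx rho) =
    fdom Goo (\row_(v < k.+1) \sum_(j < v) rho ^+ j).
  by rewrite /goo /Goo /= /plim /= partial_sums_const.
have plimE r x :
    plim g (window k.-1 r) x = plim G (sums_of_shifted_prods k r) x.
  transitivity (plim G (fun n => partial_sums (window k.-1 r n)) x) => //.
  by congr plim; apply/funext => n; exact: partial_sums_window.
(* The row vector in [condition_G] unfolds to [sums_of_shifted_prods], so the two conditions agree
   term by term. *)
split; last by split=> cond r /cond; rewrite plimE gooE domE.
split=> [acc|cond s l sl]; last first.
  pose r n := (s n.+2 - s n.+1) / (s n.+1 - s n).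
  have rr : r n @[n --> \oo] --> rho := cvg_difference_quotient rho1 sl.
  have [lim _ gooL] := cond r rr.
  (* As [x / 0 = 0], a nonzero [r n] certifies that its denominator is nonzero. *)
  have r0 : \forall n \near \oo, r n != 0.
    by apply: cvgr_neq0 rr _; rewrite -normr_gt0.
  apply/(@accelerates_iff_plim _ _ _ _ r _ rho) => //.
    near=> n; have : r n != 0 by near: n.
    by rewrite mulf_eq0 negb_or invr_eq0 => /andP[_ D0]; rewrite /r divfK.
  by rewrite -plimE -div1r -gooL.
have lim r : r n @[n --> \oo] --> rho -> plim g (window k.-1 r) L.
  move=> rr; have [|s [sl sr]] := @exists_linear_sequence _ r rho _ rr.
    by rewrite hrho0.
  by rewrite plimE; apply/(accelerates_iff_plim Greg rho1 sl sr); exact: acc.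
(* The constant sequence [rho] is itself admissible; it shows that [goo] is defined at the constant
   vector, with value [L]. *)
have limc : plim g (fun=> const_mx rho) L.
  rewrite (_ : (fun=> _) = window k.-1 (fun=> rho)); last first.
    by apply/funext => n; apply/rowP => i; rewrite !mxE.
  exact: lim (cvg_cst _).
have gooL : goo (const_mx rho) = L by exact: cvg_lim (limc.2).
move=> r /lim; rewrite gooL div1r; split => //.
by exists L.
Unshelve. all: by end_near. Qed.
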